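(* Let $\mathsf{Stages}=\{S,T\}$ and let $\mathcal{A}^\#$ be the $\mu$spec axiomatic semantics consisting of the two axioms $\forall i_1.\ \mathsf{hb}(i_1.S,i_1.T)$ and $\forall i_1,i_2.\ \mathsf{hb}(i_1.S,i_2.S)\Rightarrow \mathsf{hb}(i_1.T,i_2.T)$. Let $\mathcal{P}$ be a single-core program whose instruction stream has $m$ instructions. Then there is no operational model $\mathcal{M}=(\mathcal{Q},\Delta,q_{\mathsf{init}},q_{\mathsf{final}})$ that is sound and complete with respect to $\mathcal{A}^\#$ on the program $\mathcal{P}$ and whose number of control states satisfies $|\mathcal{Q}|<\mathcal{O}(2^m/m)$; this holds even when the history parameter is $h=\infty$. (That is, any such sound and complete model must have on the order of $2^m/m$ control states.)
   Context: Programming model: there are finitely many cores $\mathsf{Cores}=[n]$, each executing operations from a finite set $\mathbb{O}$. A program $\mathcal{P}$ is a family of finite words (instruction streams) $\mathcal{I}_c\in\mathbb{O}^*$, $c\in\mathsf{Cores}$. An instruction is a triple $(c,j,\mathcal{I}_c[j])$ with $0\le j<|\mathcal{I}_c|$; its core is $c$ and its label is $j$. $\mathsf{Instrs}(\mathcal{P})$ is the set of instructions of $\mathcal{P}$. For a finite set $\mathsf{Stages}$, events are pairs $i.\mathsf{st}$ (instruction $i$ performing stage $\mathsf{st}$); $\mathsf{Events}(\mathcal{P})=\{i.\mathsf{st}: i\in\mathsf{Instrs}(\mathcal{P}),\mathsf{st}\in\mathsf{Stages}\}$. A $\mu$hb graph for $\mathcal{P}$ is a directed acyclic graph $G=(V,E)$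 with $V=\mathsf{Events}(\mathcal{P})$; $\mathsf{hb}(e_1,e_2)$ is interpreted as $(e_1,e_2)\in E^+$ (transitive closure). An axiom is a first-order sentence with quantifiers over instruction variables and atoms $\mathsf{hb}(i_1.\mathsf{st}_1,i_2.\mathsf{st}_2)$, $i_1<_r i_2$ (same core and smaller label), and predicates on operations; quantifiers range over instructions of $\mathcal{P}$, with distinct variables assigned distinct instructions. $G\models_{\mathcal{P}}\mathcal{A}$ means $G$ satisfies all axioms of $\mathcal{A}$. A word $\sigma=e_1\cdots e_m$ of events is viewed as the linear graph $e_1\to e_2\to\cdots\to e_m$. Operational model: a tuple $(\mathcal{Q},\Delta,q_{\mathsf{init}},q_{\mathsf{final}})$ with finite control-state set $\mathcal{Q}$, initial state, absorbing final state, and history parameter $h\in\mathbb{N}\cup\{\infty\}$. It reads each core's instruction stream from a separate read-only tape with a one-way head; transitions are enabled by the current state and the instructions (or blank) under the heads, and perform an action: move a core's head right, do nothing, emit an event $i.\mathsf{st}$ for an instruction $i$ among those to the left of that core's head (identified by position, at most $h$), or drop such an instruction from the left part; configurations with more than $h$ instructions to the left of some head are disallowed. A run starts with the full streams to the right of the heads; it is accepting if it ends in $q_{\mathsf{final}}$; its trace is the sequence of emitted events; $\mathsf{Traces}(\mathcal{M},\mathcal{P})$ is the set of traces of accepting runs. $\mathcal{M}$ is sound w.r.t. $\mathcal{A}$ (on $\mathcal{P}$) if every trace in $\mathsf{Traces}(\mathcal{M},\mathcal{P})$ is a linearization (a total order of $V$ containing $E^+$) of some $\mu$hb graph $G$ with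 $G\models_{\mathcal{P}}\mathcal{A}$; it is complete if for every $G\models_{\mathcal{P}}\mathcal{A}$, $\mathsf{Traces}(\mathcal{M},\mathcal{P})$ contains all linearizations of $G$. *)

(* Defs.v *)
From HB Require Import structures.
From Stdlib Require List Relation_Operators.
From mathcomp Require Import all_boot all_order all_algebra.
Set Implicit Arguments.
Unset Strict Implicit.
Unset Printing Implicit Defensive.

Definition program (n : nat) (O : finType) : Type := 'I_n -> seq O.

(* (core, label, operation) *)
Definition instr (n : nat) (O : finType) : Type := ('I_n * nat * O)%type.

Definition core n O (i : instr n O) : 'I_n := i.1.1.
Definition label n O (i : instr n O) : nat := i.1.2.
Definition oper n O (i : instr n O) : O := i.2.

Definition stream n O (P : program n O) (c : 'I_n) : seq (instr n O) :=
  [seq (c, jo.1, jo.2) | jo <- zip (iota 0 (size (P c))) (P c)].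

Definition instrs n O (P : program n O) : {pred instr n O} :=
  [pred i | i \in stream P (core i)].

Definition event (n : nat) (O St : finType) : Type := (instr n O * St)%type.

Definition events n O St (P : program n O) : {pred event n O St} :=
  [pred e | e.1 \in instrs P].

(* [formula n O St k] has its free variables among k instruction variables.
   Variables are de Bruijn levels: the quantifier of [FAll f] or [FEx f], with
   [f : formula n O St k.+1], binds the variable of index k. *)
Inductive formula (n : nat) (O St : finType) : nat -> Type :=
| FHb k of 'I_k & St & 'I_k & St : formula n O St k
| FLt k of 'I_k & 'I_k : formula n O St k
| FOp k r of pred (r.-tuple O) & r.-tuple 'I_k : formula n O St k
| FNot k of formula n O St k : formula n O St k
| FAnd k of formula n O St k & formula n O St k : formula n O St k
| FOr k of formula n O St k & formula n O St k : formula n O St k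
| FImp k of formula n O St k & formula n O St k : formula n O St k
| FAll k of formula n O St k.+1 : formula n O St k
| FEx k of formula n O St k.+1 : formula n O St k.

Definition axiom n O St : Type := formula n O St 0.
Definition semantics n O St : Type := seq (axiom n O St).

(* The vertex set is [events P]. *)
Record uhb_graph n O St (P : program n O) := UhbGraph {
  edge : rel (event n O St);
  edge_events : forall e1 e2, edge e1 e2 ->
    (e1 \in events (St := St) P) && (e2 \in events (St := St) P);
  edge_acyclic : forall e,
    ~ Relation_Operators.clos_trans (event n O St) edge e e
}.

Definition hb n O St (P : program n O) (G : uhb_graph St P) :
    event n O St -> event n O St -> Prop :=
  Relation_Operators.clos_trans (event n O St) (edge G).

Definition ltr n O (i1 i2 : instr n O) : Prop :=
  core i1 = core i2 /\ (label i1 < label i2)%N.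

(* Variables simultaneously in scope denote distinct instructions, whence the
   condition [i \notin env] in the quantifier cases. *)
Fixpoint sat n O St (P : program n O) (G : uhb_graph St P) k
    (f : formula n O St k) : k.-tuple (instr n O) -> Prop :=
  match f in formula _ _ _ k return k.-tuple (instr n O) -> Prop with
  | FHb _ x s y t => fun env => hb G (tnth env x, s) (tnth env y, t)
  | FLt _ x y => fun env => ltr (tnth env x) (tnth env y)
  | FOp _ _ p xs => fun env => p [tuple of [seq oper (tnth env x) | x <- xs]]
  | FNot _ f => fun env => ~ sat G f env
  | FAnd _ f g => fun env => sat G f env /\ sat G g env
  | FOr _ f g => fun env => sat G f env \/ sat G g env
  | FImp _ f g => fun env => sat G f env -> sat G g env
  | FAll _ f => fun env => forall i, i \in instrs P -> i \notin env ->
      sat G f [tuple of rcons env i]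
  | FEx _ f => fun env => exists i, [/\ i \in instrs P, i \notin env &
      sat G f [tuple of rcons env i]]
  end.

Definition models n O St (P : program n O) (G : uhb_graph St P)
    (A : semantics n O St) : Prop :=
  List.Forall (fun a => sat G a [tuple]) A.

Definition linearization n O St (P : program n O) (G : uhb_graph St P)
    (w : seq (event n O St)) : Prop :=
  [/\ uniq w, w =i events (St := St) P
    & forall e1 e2, hb G e1 e2 -> (index e1 w < index e2 w)%N].

(* In [Emit c k s] and [Drop c k], k is a position in the list of remaining
   instructions to the left of the head of core c. *)
Inductive action (n : nat) (St : finType) : Type :=
| Right of 'I_n
| Stay
| Emit of 'I_n & nat & St
| Drop of 'I_n & nat.

Arguments Stay {n St}.

(* A transition reads, for each core, the instruction under its head, or
   [None] for a blank. *)
Record model (n : nat) (O St : finType) := Model {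
  state : finType;
  trans : state -> {ffun 'I_n -> option (instr n O)} ->
          action n St -> state -> Prop;
  init : state;
  final : state;
  final_absorbing : forall o a q, trans final o a q -> q = final
}.

(* Contents of the tapes to the left of the heads, in program order, and from
   the heads on. *)
Record tapes (n : nat) (O : finType) := Tapes {
  left : {ffun 'I_n -> seq (instr n O)};
  right : {ffun 'I_n -> seq (instr n O)}
}.

Definition heads n O (t : tapes n O) : {ffun 'I_n -> option (instr n O)} :=
  [ffun c => ohead (right t c)].

Definition update n (T : Type) (f : {ffun 'I_n -> T}) (c : 'I_n) (x : T) :
    {ffun 'I_n -> T} :=
  [ffun d => if d == c then x else f d].

(* [perform a t w t']: action a turns t into t' and emits the word w. *)
Inductive perform n O St :
    action n St -> tapes n O -> seq (event n O St) -> tapes n O -> Prop :=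
| PRight c i u t : right t c = i :: u ->
    perform (Right St c) t [::]
      (Tapes (update (left t) c (rcons (left t c) i)) (update (right t) c u))
| PStay t : perform Stay t [::] t
| PEmit c k s i t : onth (left t c) k = Some i ->
    perform (Emit c k s) t [:: (i, s)] t
| PDrop c k t : (k < size (left t c))%N ->
    perform (Drop St c k) t [::]
      (Tapes (update (left t) c (take k (left t c) ++ drop k.+1 (left t c)))
             (right t)).

(* History parameter; [None] stands for infinity. A position k used in a run
   satisfies k < size (left t c), so it is bounded by h as well. *)
Definition bounded n O (h : option nat) (t : tapes n O) : Prop :=
  if h is Some b then forall c, (size (left t c) <= b)%N else True.

Inductive run n O St (M : model n O St) (h : option nat) :
    state M -> tapes n O -> seq (event n O St) ->
    state M -> tapes n O -> Prop :=
| RunNil q t : bounded h t -> run h q t [::] q t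
| RunCons q1 t1 a q2 t2 w1 w2 q3 t3 :
    bounded h t1 -> trans q1 (heads t1) a q2 -> perform a t1 w1 t2 ->
    run h q2 t2 w2 q3 t3 -> run h q1 t1 (w1 ++ w2) q3 t3.

Definition init_tapes n O (P : program n O) : tapes n O :=
  Tapes [ffun => [::]] [ffun c => stream P c].

Definition trace n O St (M : model n O St) (h : option nat)
    (P : program n O) (w : seq (event n O St)) : Prop :=
  exists t, run h (init M) (init_tapes P) w (final M) t.

Definition sound n O St (M : model n O St) (h : option nat)
    (A : semantics n O St) (P : program n O) : Prop :=
  forall w, trace M h P w ->
    exists G : uhb_graph St P, models G A /\ linearization G w.

Definition complete n O St (M : model n O St) (h : option nat)
    (A : semantics n O St) (P : program n O) : Prop :=
  forall G : uhb_graph St P, models G A ->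
    forall w, linearization G w -> trace M h P w.

Inductive stage : Type := StS | StT.

Definition bool_of_stage (s : stage) : bool := if s is StS then true else false.
Definition stage_of_bool (b : bool) : stage := if b then StS else StT.
Lemma bool_of_stageK : cancel bool_of_stage stage_of_bool.
Proof. by case. Qed.

HB.instance Definition _ := Finite.copy stage (can_type bool_of_stageK).

Definition axiom_ST n O : axiom n O stage :=
  let i1 : 'I_1 := ord0 in FAll (FHb n O i1 StS i1 StT).

Definition axiom_SSTT n O : axiom n O stage :=
  let i1 : 'I_2 := ord0 in let i2 : 'I_2 := ord_max in
  FAll (FAll (FImp (FHb n O i1 StS i2 StS) (FHb n O i1 StT i2 StT))).

Definition A_sharp n O : semantics n O stage :=
  [:: axiom_ST n O; axiom_SSTT n O].

(* Main.v *)
(* The graph whose only edges are i.S -> i.T satisfies A#, so a complete model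
   accepts, for every set X of instructions, the word that emits X.S, X.T, X^c.S,
   X^c.T. When X.S has just been emitted, every instruction still has to emit its
   T, so none has been dropped; hence the tapes are determined by the position of
   the head, and there are at most |Q| (m + 1) configurations. If X and Y share one,
   the continuation of Y after X.S is accepted too, and it never emits i.S for
   i in Y \ X; soundness then forces X = Y. So 2^m <= |Q| (m + 1). *)
Require Import Defs.
From mathcomp Require Import all_boot all_order all_algebra.
From mathcomp Require Import zify.
From Stdlib Require List Relation_Operators.
Import Order.TTheory GRing.Theory Num.Theory.
Local Open Scope ring_scope.

Set Implicit Arguments.
Unset Strict Implicit.
Unset Printing Implicit Defensive.

(** * Cutting and joining runs; what the tapes retain *)

Section Runs.

Variables (n : nat) (O St : finType) (M : model n O St) (h : option nat).
Implicit Types (q : state M) (t : tapes n O) (u v w : seq (event n O St)).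

Lemma run_cat q1 t1 u q2 t2 v q3 t3 :
  run h q1 t1 u q2 t2 -> run h q2 t2 v q3 t3 -> run h q1 t1 (u ++ v) q3 t3.
Proof.
elim=> {q1 t1 u q2 t2} // q1 t1 a q2 t2 w1 w2 q4 t4 bt1 tr pf _ IH r.
by rewrite -catA; apply: RunCons bt1 tr pf (IH r).
Qed.

(** One action emits at most one event, so a cut of the trace never falls inside a step. *)
Lemma run_split q1 t1 u v q3 t3 : run h q1 t1 (u ++ v) q3 t3 ->
  exists q2 t2, run h q1 t1 u q2 t2 /\ run h q2 t2 v q3 t3.
Proof.
move Ew: (u ++ v) => w r; elim: r u Ew => {q1 t1 w q3 t3}.
  move=> q t bt [|//] /= ->.
  by exists q, t; split; apply: RunNil.
move=> q1 t1 a q2 t2 w1 w2 q3 t3 bt1 tr pf r IH [|e u] /= Ew.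
  by exists q1, t1; split; [apply: RunNil | rewrite Ew; apply: RunCons bt1 tr pf r].
have sw1 : w1 = [::] \/ exists e', w1 = [:: e'].
  by case: pf => *; [left | left | right; eexists | left].
case: sw1 => [w10|[e' w1e]].
  have [|q4 [t4 [r1 r2]]] := IH (e :: u); first by rewrite w10 in Ew.
  exists q4, t4; split=> //.
  by rewrite -[e :: u]/([::] ++ e :: u) -w10; apply: RunCons bt1 tr pf r1.
move: Ew; rewrite w1e => -[ee' /IH [q4 [t4 [r1 r2]]]].
exists q4, t4; split=> //; subst w1 e'.
by rewrite -cat1s; apply: RunCons bt1 tr pf r1.
Qed.

(** An invariant of runs: moving a head preserves the concatenation, and a drop only deletes from
    it. *)
Definition subseq_tapes (P : program n O) t := forall c,
  subseq (left t c ++ right t c) (stream P c).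

Lemma subseq_init (P : program n O) : subseq_tapes P (init_tapes P).
Proof. by move=> c; rewrite !ffunE. Qed.

Lemma perform_subseq a t w t' c : perform a t w t' ->
  subseq (left t' c ++ right t' c) (left t c ++ right t c).
Proof.
case=> {a t w t'} // [d i u t tE|d k t _] /=; rewrite !ffunE; case: eqP => // ->.
  by rewrite tE cat_rcons.
rewrite cat_subseq //.
rewrite -[X in subseq _ X](cat_take_drop k) cat_subseq //.
by rewrite -addn1 addnC -drop_drop drop_subseq.
Qed.

Lemma run_subseq (P : program n O) q t w q' t' :
  run h q t w q' t' -> subseq_tapes P t -> subseq_tapes P t'.
Proof.
elim=> // {q t w q' t'} q1 t1 a q2 t2 w1 w2 q3 t3 _ _ pf _ IH Rt; apply: IH => c.
exact: subseq_trans (perform_subseq c pf) (Rt c).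
Qed.

(** No action puts a dropped instruction back, so whatever is emitted later is still on a tape
    now. *)
Lemma run_emits q t w q' t' e : run h q t w q' t' -> e \in w ->
  exists c, e.1 \in left t c ++ right t c.
Proof.
elim=> // {q t w q' t'} q1 t1 a q2 t2 w1 w2 q3 t3 _ _ pf _ IH.
rewrite mem_cat => /orP[ew1|/IH[c ec]]; last first.
  by exists c; apply: mem_subseq (perform_subseq c pf) _ ec.
case: pf ew1 => [d i u t _|t|c k s i t ti|d k t _] //.
rewrite inE => /eqP -> /=; exists c.
by rewrite mem_cat; apply/orP; left; apply/onthP; exists k.
Qed.

(** A subsequence of a duplicate-free stream that contains all its elements has full length, hence
    is the stream; only the head position [k] remains free. *)
Lemma undropped_tapes (P : program n O) : (forall c, uniq (stream P c)) ->
  forall t c, subseq_tapes P t -> {subset stream P c <= left t c ++ right t c} ->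
  let k := (size (stream P c) - size (right t c))%N in
  left t c = take k (stream P c) /\ right t c = drop k (stream P c).
Proof.
move=> uP t c Rt sub k.
have ss := Rt c.
have E : left t c ++ right t c = stream P c.
  by apply/eqP; rewrite -(size_subseq_leqif ss).2 eqn_leq size_subseq // uniq_leq_size.
by rewrite /k -E size_cat addnK take_size_cat // drop_size_cat.
Qed.

End Runs.

Section Streams.

Variables (n : nat) (O : finType) (P : program n O).

Lemma stream_labels c : [seq label i | i <- stream P c] = iota 0 (size (P c)).
Proof.
rewrite -map_comp (eq_map (g := fst)) //.
by rewrite -/(unzip1 _) unzip1_zip // size_iota.
Qed.

Lemma size_stream c : size (stream P c) = size (P c).
Proof. by rewrite -(size_map (@label n O)) stream_labels size_iota. Qed.

Lemma stream_uniq c : uniq (stream P c).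
Proof. by apply: (@map_uniq _ _ (@label n O)); rewrite stream_labels iota_uniq. Qed.

End Streams.

(** * The graph with the fewest constraints *)

Section MinimalGraph.

Variables (n : nat) (O : finType) (P : program n O).

Definition ST_edge : rel (event n O stage) := fun e1 e2 =>
  [&& e1.1 \in instrs P, e1.1 == e2.1, e1.2 == StS & e2.2 == StT].

Lemma ST_edge_events e1 e2 : ST_edge e1 e2 ->
  (e1 \in events (St := stage) P) && (e2 \in events (St := stage) P).
Proof. by case/and4P=> e1P /eqP e12 _ _; rewrite !inE -e12 andbb. Qed.

(** Edges lead from stage [StS] to stage [StT], so no two of them compose. *)
Lemma ST_edge_clos_trans e1 e2 :
  Relation_Operators.clos_trans _ ST_edge e1 e2 -> ST_edge e1 e2.
Proof.
elim=> // x y z _ /and4P[_ _ _ /eqP yT] _ /and4P[_ _ /eqP yS _].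
by rewrite yT in yS.
Qed.

Lemma ST_edge_acyclic e : ~ Relation_Operators.clos_trans _ ST_edge e e.
Proof. by move/ST_edge_clos_trans/and4P=> [_ _ /eqP ->]. Qed.

Definition ST_graph : uhb_graph stage P :=
  UhbGraph ST_edge_events ST_edge_acyclic.

Lemma ST_graph_models : models ST_graph (A_sharp n O).
Proof.
apply: List.Forall_cons; last apply: List.Forall_cons; last exact: List.Forall_nil.
  move=> i iP _ /=; apply: Relation_Operators.t_step.
  by rewrite /= !(tnth_nth i) /ST_edge /= iP !eqxx.
(* The second axiom holds vacuously: no edge ends in an [StS] event. *)
by move=> i _ _ j _ _ /= /ST_edge_clos_trans /and4P[].
Qed.

End MinimalGraph.

(** * The words indexed by sets of instructions *)

Section Words.

Variables (O : finType) (P : program 1 O).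

Let s := stream P ord0.

Definition emit_all (st : stage) (p : pred (instr 1 O)) : seq (event 1 O stage) :=
  [seq (i, st) | i <- s & p i].

(** What remains after the block [emit_all StS p]: it has the [StT] event of every instruction, but
    [StS] events only outside [p]. *)
Definition word_tail (p : pred (instr 1 O)) :=
  emit_all StT p ++ emit_all StS (predC p) ++ emit_all StT (predC p).

Lemma mem_events1 (e : event 1 O stage) :
  (e \in events (St := stage) P) = (e.1 \in s).
Proof. by rewrite !inE (ord1 (core e.1)). Qed.

Lemma mem_emit_all st p i st' :
  ((i, st') \in emit_all st p) = [&& st' == st, p i & i \in s].
Proof.
apply/mapP/and3P => [[j + [-> ->]]|[/eqP -> pi si]].
  by rewrite mem_filter => /andP[].
by exists i; rewrite ?mem_filter ?pi.
Qed.

Lemma emit_all_uniq st p : uniq (emit_all st p).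
Proof. by rewrite map_inj_uniq ?filter_uniq ?stream_uniq // => i j []. Qed.

Lemma index_cat_lt (T : eqType) (u v : seq T) x y : x \in u -> y \notin u ->
  (index x (u ++ v) < index y (u ++ v))%N.
Proof.
move=> xu /negbTE yu; rewrite !index_cat xu yu.
by rewrite ltn_addr // index_mem.
Qed.

Lemma word_linearization p :
  linearization (ST_graph P) (emit_all StS p ++ word_tail p).
Proof.
have disj st st' (p1 p2 : pred (instr 1 O)) :
    (forall i, st = st' -> p1 i -> ~~ p2 i) ->
    ~~ has (mem (emit_all st p1)) (emit_all st' p2).
  move=> dis; apply/hasPn => -[i st2]; rewrite mem_emit_all.
  case/and3P=> /eqP -> p2i _; rewrite /= mem_emit_all; apply/and3P.
  by case=> /eqP Est p1i _; move: (dis i (esym Est) p1i); rewrite p2i.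
have pC i : p i -> ~~ predC p i by rewrite /= negbK.
split.
- rewrite /word_tail !cat_uniq !has_cat !emit_all_uniq /= !negb_or.
  by rewrite !disj => [|i|i|i|i|i|i] // _; apply: pC.
- move=> -[i st]; rewrite mem_events1 !mem_cat !mem_emit_all /=.
  by case: st; rewrite ?eqxx /=; case: (p i); case: (i \in s).
move=> [i1 st1] [i st2] /ST_edge_clos_trans /and4P[/= iP /eqP ? /eqP ? /eqP ?].
subst i1 st1 st2.
have si : i \in s by rewrite -(mem_events1 (i, StS)).
have [pi|npi] := boolP (p i).
  by apply: index_cat_lt; rewrite mem_emit_all /= ?pi ?si.
(* Outside [p], the cut that separates the two events of [i] is before the last block. *)
rewrite /word_tail !catA; apply: index_cat_lt.
  by rewrite !mem_cat !mem_emit_all /= npi si !orbT.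
by rewrite !mem_cat !mem_emit_all /= (negbTE npi).
Qed.

End Words.

(** * Counting configurations *)

Section CountingStates.

Variables (O : finType) (P : program 1 O) (h : option nat) (M : model 1 O stage).
Hypotheses (soundM : sound M h (A_sharp 1 O) P)
           (completeM : complete M h (A_sharp 1 O) P).

Let m := size (P ord0).
Let s := stream P ord0.

Definition full_tapes (k : nat) : tapes 1 O :=
  Tapes [ffun=> take k s] [ffun=> drop k s].

Definition splits_at (p : pred (instr 1 O)) (qk : state M * 'I_m.+1) : Prop :=
  run h (init M) (init_tapes P) (emit_all P StS p) qk.1 (full_tapes qk.2) /\
  exists t, run h qk.1 (full_tapes qk.2) (word_tail P p) (final M) t.

Lemma exists_splits_at p : exists qk, splits_at p qk.
Proof.
have [t r] := completeM (ST_graph_models P) (word_linearization P p).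
have [q [t' [r1 r2]]] := run_split r.
have Rt := run_subseq r1 (subseq_init P).
have sub : {subset s <= left t' ord0 ++ right t' ord0}.
  (* The [StT] event of [i] is still to come, whether or not [p i] holds. *)
  move=> i si; have [|c] := run_emits (e := (i, StT)) r2.
    by rewrite !mem_cat !mem_emit_all /= si; case: (p i).
  by rewrite (ord1 c).
have [tl tr] := undropped_tapes (stream_uniq P) Rt sub.
have km : (size s - size (right t' ord0) < m.+1)%N.
  by rewrite ltnS /s size_stream leq_subr.
have Et : t' = full_tapes (Ordinal km).
  case: t' tl tr {r1 r2 Rt sub} km => L R /= tl tr km.
  by congr Tapes; apply/ffunP=> c; rewrite ffunE (ord1 c).
by exists (q, Ordinal km); rewrite /splits_at -Et; split=> //; exists t.
Qed.

(** Splice the first half for [p] with the second half for [p']. By soundness the result contains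
    the [StS] event of [i]; if [p' i] holds, only the first half can supply it. *)
Lemma splits_at_sub p p' qk : splits_at p qk -> splits_at p' qk ->
  {in s, forall i, p' i -> p i}.
Proof.
move=> [r1 _] [_ [t r2]] i si p'i.
have [|G [_ [_ wE _]]] := soundM (w := emit_all P StS p ++ word_tail P p').
  by exists t; apply: run_cat r1 r2.
move: (wE (i, StS)); rewrite mem_events1 !mem_cat !mem_emit_all /=.
by rewrite -/s si p'i !andbT !orbF.
Qed.

(** Bit vectors make the sets of instructions a finite type of size [2 ^ m]; labels in the stream
    are below [m], so the default is never read there. *)
Definition bits_pred (X : m.-tuple bool) : pred (instr 1 O) :=
  fun i => nth false X (label i).

Lemma state_lower_bound : (2 ^ m <= #|state M| * m.+1)%N.
Proof.
have [f fP] := fin_all_exists (fun X => exists_splits_at (bits_pred X)).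
have sub X Y : f X = f Y -> forall k, (k < m)%N ->
    nth false Y k -> nth false X k.
  move=> fXY k km Yk.
  have /mapP[i si Ek] : k \in [seq label i | i <- s].
    by rewrite stream_labels mem_iota.
  rewrite Ek; apply: (splits_at_sub (p := bits_pred X) (p' := bits_pred Y) (qk := f X)) si _.
  - exact: fP.
  - by rewrite fXY; apply: fP.
  - by rewrite /bits_pred -Ek.
have f_inj : injective f.
  move=> X Y fXY; apply: val_inj; apply: (@eq_from_nth _ false).
    by rewrite !size_tuple.
  move=> k; rewrite size_tuple => km.
  by apply/idP/idP; apply: sub.
by have := leq_card f f_inj; rewrite card_tuple card_bool card_prod card_ord.
Qed.

End CountingStates.

Theorem theorem1 :
  exists2 c : rat, 0 < c &
    forall (O : finType) (m : nat) (P : program 1 O) (h : option nat),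
      (0 < m)%N -> size (P ord0) = m ->
      ~ exists M : model 1 O stage,
          [/\ sound M h (A_sharp 1 O) P,
              complete M h (A_sharp 1 O) P
            & #|state M|%:R < c * (2 ^+ m / m%:R)].
Proof.
(* The constant 1/2 absorbs the passage from [m.+1] to [m]: for positive [m], [m.+1] is at most
   [2 * m]. *)
exists 2^-1 => // O m P h m_gt0 sizeP [M [soundM completeM]].
have := state_lower_bound soundM completeM; rewrite sizeP => le2m.
rewrite mulrA ltr_pdivlMr ?ltr0n // ltr_pdivlMl //.
by rewrite -!natrM -natrX ltr_nat; nia.
Qed.
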